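(* Let $q$ be a prime power, let $m\in\mathbb{F}_q[x]$ be a monic irreducible cubic, and let $\Gamma_m$ be the graph with vertex set $V(\Gamma_m)=\mathcal{C}(m)$ in which $A\sim B$ if and only if $A-B$ is invertible. (1) $|V(\Gamma_m)|=(q^3-q)(q^3-q^2)$. (2) $\Gamma_m$ is vertex-transitive. (3) $\Gamma_m$ is regular of degree $(q^3-q^2-q)(q^3-q^2-q-1)$. (4) $\Gamma_m$ has a clique of size $q^3-q^2-q$.
   Context: $\mathcal{C}(m)$ is the set of all $3\times 3$ matrices $A$ over $\mathbb{F}_q$ whose minimal polynomial is $m$. *)

(* Defs.v *)
From HB Require Import structures.
From mathcomp Require Import all_boot all_order all_fingroup all_algebra.

Set Implicit Arguments.
Unset Strict Implicit.
Unset Printing Implicit Defensive.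

Import GRing.Theory.

Record sgraph := SGraph {
  vertex : finType;
  adj : rel vertex;
  adj_sym : symmetric adj;
  adj_irr : irreflexive adj }.

Arguments adj : clear implicits.

Definition graph_aut (G : sgraph) (f : {perm vertex G}) : Prop :=
  forall x y : vertex G, adj G (f x) (f y) = adj G x y.

Definition vertex_transitive (G : sgraph) : Prop :=
  forall x y : vertex G, exists2 f : {perm vertex G}, graph_aut f & f x = y.

Definition regular_of_degree (G : sgraph) (d : nat) : Prop :=
  forall x : vertex G, #|[set y | adj G x y]| = d.

Definition clique (G : sgraph) (S : {set vertex G}) : Prop :=
  {in S &, forall x y : vertex G, x != y -> adj G x y}.

Section MinpolyGraph.
Local Open Scope ring_scope.
Variables (F : finFieldType) (m : {poly F}).

Definition minpoly_class : {set 'M[F]_3} := [set A | mxminpoly A == m].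

Definition gamma_vertex : finType := {A : 'M[F]_3 | A \in minpoly_class}.

Definition gamma_adj : rel gamma_vertex :=
  fun A B => val A - val B \in unitmx.

Fact gamma_adj_sym : symmetric gamma_adj.
Proof.
by move=> A B; rewrite /gamma_adj -opprB -scaleN1r unitmxZ ?unitrN1.
Qed.

Fact gamma_adj_irr : irreflexive gamma_adj.
Proof. by move=> A; rewrite /gamma_adj subrr unitmxE det0 unitr0. Qed.

Definition Gamma : sgraph := SGraph gamma_adj_sym gamma_adj_irr.

End MinpolyGraph.

(* Main.v *)
Require Import Defs.
From mathcomp Require Import all_boot all_order all_fingroup all_algebra.
From mathcomp Require Import mxabelem finfield.
From mathcomp Require Import zify ring.

(** An irreducible [m] makes every nonzero row vector [v] cyclic for every root
    [A] of [m], so [A] is determined by [v], [v A], [v A^2], which may be an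
    arbitrary basis with first element [v]. Hence, for [v] and [w] independent,
    exactly [q^3 - q^2] roots map [v] to [w], which gives the number of
    vertices. Two distinct roots agree on a space of dimension at most one, since
    a common plane would contain some [v] together with [v A]; counting pairs
    [(v, B)] with [v A = v B] then gives the degree.

    For the clique, let [alpha] be a root of [m] in [F_(q^3)]. A vertex [B] is
    encoded by its [alpha]-eigenline, a point of [PG(2, q^3)] on no
    [F_q]-rational line, and two vertices are adjacent unless the line joining
    their points contains a rational point. The points of a line without
    rational points thus form a clique once those [q^2 + q + 1] lying on rational
    lines are discarded. For the line with coefficients [1, alpha, alpha^2], the
    condition on [B] is [e_0 + e_1 B + e_2 B^2 = 0], which no longer mentions the
    extension field. *)

Set Implicit Arguments.
Unset Strict Implicit.
Unset Printing Implicit Defensive.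

Import GRing.Theory.
Local Open Scope ring_scope.

(** * Krylov matrices at roots of an irreducible polynomial *)

Section Krylov.
Variables (F : fieldType) (n : nat).
Implicit Types (A B : 'M[F]_n.+1) (v : 'rV[F]_n.+1) (p : {poly F}).

Definition krylov v A : 'M[F]_n.+1 := \matrix_i (v *m A ^+ i).

(** The dimension is a parameter instead of being computed from [size p], so that powers and
    products with other matrices typecheck without casts. *)
Definition companion p : 'M[F]_n.+1 :=
  \matrix_(i, j) if i == n :> nat then - p`_j else (i.+1 == j :> nat)%:R.

Lemma horner_mx_sum A p d : (size p <= d)%N ->
  horner_mx A p = \sum_(i < d) p`_i *: A ^+ i.
Proof.
move=> szp; have {1}-> : p = \poly_(i < d) p`_i.
  apply/polyP=> i; rewrite coef_poly; case: ltnP => // le_d.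
  by rewrite nth_default // (leq_trans szp).
rewrite poly_def linear_sum /=; apply: eq_bigr => i _.
by rewrite linearZ /= rmorphXn /= horner_mx_X.
Qed.

(** Linear relations among the rows [v A^i] become polynomials in [A] that kill [v], hence questions
    of divisibility by [m]. *)
Lemma mulmx_krylov v A (x : 'rV_n.+1) :
  x *m krylov v A = v *m horner_mx A (rVpoly x).
Proof.
rewrite mulmx_sum_row (@horner_mx_sum _ _ n.+1) ?size_poly // mulmx_sumr.
by apply: eq_bigr => i _; rewrite rowK coef_rVpoly_ord scalemxAr.
Qed.

Lemma krylov_conj v A g : g \in unitmx ->
  krylov v (invmx g *m A *m g) = krylov (v *m invmx g) A *m g.
Proof.
move=> gU; apply/row_matrixP=> i; rewrite row_mul !rowK -!mulmxA; congr (v *m _).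
have := horner_mx_uconjC 'X^i A gU.
by rewrite !rmorphXn /= !horner_mx_X -!mulmxA.
Qed.

Lemma krylov_companion p : krylov (delta_mx 0 0) (companion p) = 1%:M.
Proof.
have rowC : forall i : nat, (i < n.+1)%N ->
  delta_mx 0 0 *m companion p ^+ i = delta_mx 0 (inord i) :> 'rV_n.+1.
  elim=> [|i IHi] lt_i; first
    by rewrite expr0 mulmx1; congr delta_mx; apply/val_inj; rewrite /= inordK.
  rewrite exprSr mulmxA IHi ?(ltnW lt_i) // -rowE; apply/rowP=> j.
  rewrite !mxE inordK ?(ltnW lt_i) // ltn_eqF // eqxx /=.
  by rewrite -val_eqE /= inordK // eq_sym.
apply/row_matrixP=> i; rewrite rowK rowC // inord_val.
by rewrite rowE mulmx1.
Qed.

Variable m : {poly F}.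
Hypotheses (m_monic : m \is monic) (m_irr : irreducible_poly m).
Hypothesis size_m : size m = n.+2.

Lemma companion_root : horner_mx (companion m) m = 0.
Proof.
suff {2}<-: char_poly (companion m) = m by exact: Cayley_Hamilton.
have := companionmxK m_monic; rewrite /companionmx.
(* The dimension [(size m).-1] of [companionmx] is made a variable, so that [n.+1] can replace it
   throughout the dependent types. *)
by move: (_.-1) (congr1 predn size_m) => d /= ->.
Qed.

(** If [m] kills [A], the minimal polynomial is a nonconstant monic divisor of [m], hence [m]
    itself. *)
Lemma mxminpoly_irreducible A : (mxminpoly A == m) = (horner_mx A m == 0).
Proof.
apply/idP/idP=> [/eqP <-|]; first by rewrite mx_root_minpoly.
rewrite -dvd_mxminpoly => dvdm.
rewrite -eqp_monic ?mxminpoly_monic //; apply: m_irr.2 => //.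
by rewrite size_mxminpoly eqSS -lt0n mxminpoly_nonconstant.
Qed.

(* The inverse is given by one polynomial, valid for all roots of [m] at once. *)
Lemma horner_mx_inv p : ~~ (m %| p) ->
  exists s, forall A, horner_mx A m = 0 ->
    horner_mx A p *m horner_mx A s = 1%:M.
Proof.
move=> ndvd; have cop : coprimep m p.
  rewrite coprimep_def; apply: contraR ndvd => sz.
  have := m_irr.2 _ sz (dvdp_gcdl m p) => /eqp_dvdl <-.
  exact: dvdp_gcdr.
have [[u s] /= def1] := Bezout_eq1_coprimepP _ _ cop.
exists s => A mA0; have := congr1 (horner_mx A) def1.
by rewrite rmorphD !rmorphM rmorph1 /= mA0 mulr0 add0r (comm_horner_mx2 A s p).
Qed.

Lemma mulmx_horner_eq0 A v p : horner_mx A m = 0 -> v != 0 ->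
  v *m horner_mx A p = 0 -> m %| p.
Proof.
move=> mA0 v0 vp0; apply: contraR v0 => /horner_mx_inv[s /(_ A mA0) ps1].
by rewrite -[v]mulmx1 -ps1 mulmxA vp0 mul0mx.
Qed.

(** A relation among the rows is a polynomial of degree at most [n] killing [v]; being divisible by
    [m], of degree [n + 1], it is zero. *)
Lemma krylov_unit A v : horner_mx A m = 0 -> v != 0 -> krylov v A \in unitmx.
Proof.
move=> mA0 v0; rewrite -row_free_unit -kermx_eq0; apply/rowV0P => x /sub_kermxP.
rewrite mulmx_krylov => /(mulmx_horner_eq0 mA0 v0) /dvdp_leq szx.
have /eqP x0 : rVpoly x == 0.
  by apply: contraT => /szx; rewrite size_m leqNgt ltnS size_poly.
by rewrite -[x]rVpolyK x0 linear0.
Qed.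

(** Both sides send row [v A^i] to [v A^(i+1)]; in the last row this is the equation [m(A) = 0]
    solved for its leading term. *)
Lemma krylov_mulmx A v : horner_mx A m = 0 ->
  krylov v A *m A = companion m *m krylov v A.
Proof.
move=> mA0; apply/row_matrixP=> i; rewrite row_mul rowK -mulmxA mulmxE -exprSr.
rewrite [in RHS]row_mul [in RHS]mulmx_sum_row.
have [i_n|i_n] := eqVneq (i : nat) n; last first.
  have lt_i : (i.+1 < n.+1)%N by rewrite ltnS ltn_neqAle i_n -ltnS ltn_ord.
  rewrite (bigD1 (Ordinal lt_i)) //= big1 => [|j ne_j].
    by rewrite rowK !mxE (negPf i_n) eqxx scale1r addr0.
  rewrite !mxE (negPf i_n) -[_ == _ :> nat]/(Ordinal lt_i == j).
  by rewrite eq_sym (negPf ne_j) scale0r.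
have := mA0; rewrite (@horner_mx_sum _ _ n.+2) ?size_m // big_ord_recr /=.
have := m_monic; rewrite monicE /lead_coef size_m /= => /eqP ->.
rewrite scale1r => /eqP; rewrite addrC addr_eq0 i_n => /eqP ->.
rewrite mulmxN mulmx_sumr -sumrN; apply: eq_bigr => j _.
by rewrite rowK !mxE i_n eqxx scaleNr -scalemxAr.
Qed.

Lemma krylov_inj A B v : horner_mx A m = 0 -> horner_mx B m = 0 -> v != 0 ->
  krylov v A = krylov v B -> A = B.
Proof.
move=> mA0 mB0 v0 eqAB; rewrite -[A](mulKmx (krylov_unit mA0 v0)).
by rewrite krylov_mulmx // eqAB -krylov_mulmx // mulKmx // krylov_unit.
Qed.

Lemma krylov_similar A v : horner_mx A m = 0 -> v != 0 ->
  A = invmx (krylov v A) *m companion m *m krylov v A.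
Proof.
by move=> mA0 v0; rewrite -mulmxA -krylov_mulmx // mulKmx // krylov_unit.
Qed.

End Krylov.

(** * Ranks and determinants of matrices given by three rows *)

Section Rows3.
Variables (F : fieldType).

Lemma mxrank_adds_row p n (A : 'M[F]_(p, n)) (w : 'rV_n) :
  \rank (A + w)%MS = (\rank A + ~~ (w <= A)%MS)%N.
Proof.
case: (boolP (w <= A)%MS) => [/addsmx_idPl -> | nwA]; first by rewrite addn0.
have w0 : w != 0 by apply: contraNneq nwA => ->; rewrite sub0mx.
have cap0 : (A :&: w = 0)%MS.
  apply/eqP; apply: contraR nwA => cap0.
  apply: submx_trans (capmxSl A w).
  by rewrite -(geq_leqif (mxrank_leqif_sup (capmxSr A w))) rank_rV w0 lt0n mxrank_eq0.
by rewrite mxrank_disjoint_sum // rank_rV w0.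
Qed.

Definition rows3 (u v w : 'rV[F]_3) : 'M[F]_3 := \matrix_i [:: u; v; w]`_i.

Lemma rows3_sums u v w : (rows3 u v w :=: u + v + w)%MS.
Proof.
apply/eqmxP/andP; split.
  apply/row_subP => i; rewrite rowK.
  case: i => [[|[|[|//]]] lt_i] /=.
  - by rewrite -addsmxA addsmxSl.
  - by rewrite (submx_trans (addsmxSr u v)) ?addsmxSl.
  - exact: addsmxSr.
rewrite !addsmx_sub -!andbA; apply/and3P; split.
- by apply: (eq_row_sub 0); rewrite rowK.
- by apply: (eq_row_sub 1); rewrite rowK.
- by apply: (eq_row_sub 2%:R); rewrite rowK.
Qed.

Lemma rows3_unit u v w : u != 0 -> ~~ (v <= u)%MS ->
  (rows3 u v w \in unitmx) = ~~ (w <= u + v)%MS.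
Proof.
move=> u0 nvu; rewrite -row_full_unit /row_full rows3_sums.
by rewrite !mxrank_adds_row rank_rV u0 nvu; case: (w <= _)%MS.
Qed.

Lemma det_rows3 u v w : \det (rows3 u v w) =
  u 0 0 * (v 0 1 * w 0 2%:R - v 0 2%:R * w 0 1)
  - u 0 1 * (v 0 0 * w 0 2%:R - v 0 2%:R * w 0 0)
  + u 0 2%:R * (v 0 0 * w 0 1 - v 0 1 * w 0 0).
Proof.
rewrite (expand_det_row _ 0) !big_ord_recl big_ord0 /cofactor.
rewrite !(expand_det_row _ 0) !big_ord_recl !big_ord0 /cofactor !det_mx11 !mxE /=.
do ![rewrite (_ : lift _ _ = 1); last exact: val_inj
   | rewrite (_ : lift _ _ = 0); last exact: val_inj
   | rewrite (_ : lift _ _ = 2%:R); last exact: val_inj].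
rewrite /bump /= !(addn0, addn1, add0n, add1n, expr0, expr1, exprS).
ring.
Qed.

End Rows3.

Lemma degree_arith (q s d : nat) : (1 < q)%N ->
  (s * q.-1 = (q ^ 3).-1 * (q ^ 3 - q ^ 2).-1)%N ->
  ((q ^ 3 - q) * (q ^ 3 - q ^ 2) = 1 + s + d)%N ->
  d = ((q ^ 3 - q ^ 2 - q) * (q ^ 3 - q ^ 2 - q - 1))%N.
Proof.
(* Writing [q = k + 2] turns every truncated subtraction into a polynomial in [k] with nonnegative
   coefficients. *)
case: q => [|[|k]] // _; rewrite -[k.+2.-1]/k.+1.
have -> : ((k.+2 ^ 3).-1 = (k ^ 2 + 5 * k + 7) * k.+1)%N.
  by apply/eqP; rewrite -eqSS prednK ?expn_gt0 //; apply/eqP; ring.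
have -> : (k.+2 ^ 3 - k.+2 = (k + 1) * (k + 2) * (k + 3))%N.
  by apply: (canLR (addnK _)); ring.
have -> : (k.+2 ^ 3 - k.+2 ^ 2 = (k ^ 3 + 5 * k ^ 2 + 8 * k + 3).+1)%N.
  by apply: (canLR (addnK _)); ring.
have -> : ((k ^ 3 + 5 * k ^ 2 + 8 * k + 3).+1 - k.+2
    = (k ^ 3 + 5 * k ^ 2 + 7 * k + 1).+1)%N.
  by apply: (canLR (addnK _)); ring.
rewrite subn1 /= mulnAC => /eqP; rewrite eqn_pmul2r // => /eqP -> eqd.
apply/eqP;
  rewrite -(eqn_add2l (1 + (k ^ 2 + 5 * k + 7) * (k ^ 3 + 5 * k ^ 2 + 8 * k + 3))).
by rewrite -eqd; apply/eqP; ring.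
Qed.

Lemma card_sig_set (T : finType) (S : {set T}) (P : pred T) :
  #|[set x : {y | y \in S} | P (val x)]| = #|[set y in S | P y]|.
Proof.
rewrite -(card_imset _ val_inj); apply: eq_card => y; rewrite inE.
apply/imsetP/andP => [[x] | [Sy Py]]; first by rewrite inE => Px ->; rewrite (valP x).
by exists (Sub y Sy); rewrite ?inE SubK.
Qed.

(** * Conjugacy and number of the roots of a cubic *)

Section MinpolyClass.
Variables (F : finFieldType) (m : {poly F}).
Hypotheses (m_monic : m \is monic) (m_irr : irreducible_poly m).
Hypothesis size_m : size m = 4.
Implicit Types (A B : 'M[F]_3) (r u v w : 'rV[F]_3).
Local Notation q := #|F|.
Local Notation C := (companion 2 m).

Lemma delta00_neq0 : delta_mx 0 0 != 0 :> 'rV[F]_3.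
Proof. by apply/eqP=> /rowP/(_ 0)/eqP; rewrite !mxE eqxx oner_eq0. Qed.

Lemma mem_minpoly_class A : (A \in minpoly_class m) = (horner_mx A m == 0).
Proof. by rewrite inE mxminpoly_irreducible. Qed.

Lemma minpoly_class_conj A g : g \in unitmx -> A \in minpoly_class m ->
  invmx g *m A *m g \in minpoly_class m.
Proof.
rewrite !mem_minpoly_class => gU /eqP mA0.
by rewrite horner_mx_uconjC // mA0 mulmx0 mul0mx.
Qed.

Lemma companion_class : C \in minpoly_class m.
Proof. by rewrite mem_minpoly_class companion_root. Qed.

(** This realizes an arbitrary basis as a Krylov basis: conjugation by [g] carries the standard
    basis, which is the one of [C] at [e_0], to the rows of [g]. *)
Lemma krylov_companion_conj g : g \in unitmx ->
  krylov (row 0 g) (invmx g *m C *m g) = g.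
Proof.
by move=> gU; rewrite krylov_conj // rowE mulmxK // krylov_companion mul1mx.
Qed.

Lemma krylov_rows3 v A : krylov v A = rows3 v (v *m A) (v *m A ^+ 2).
Proof.
apply/row_matrixP=> i; rewrite !rowK.
by case: i => [[|[|[|//]]] lt_i]; rewrite /= ?expr0 ?mulmx1 ?expr1.
Qed.

Lemma class_conjugate A B : A \in minpoly_class m -> B \in minpoly_class m ->
  exists2 g, g \in unitmx & B = invmx g *m A *m g.
Proof.
rewrite !mem_minpoly_class // => /eqP mA0 /eqP mB0.
have v0 := delta00_neq0.
have AU := krylov_unit m_irr size_m mA0 v0.
have BU := krylov_unit m_irr size_m mB0 v0.
have gU : invmx (krylov (delta_mx 0 0) A) *m krylov (delta_mx 0 0) B \in unitmx.
  by rewrite unitmx_mul unitmx_inv AU.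
exists (invmx (krylov (delta_mx 0 0) A) *m krylov (delta_mx 0 0) B) => //.
rewrite -mulmxA; apply: (canRL (mulKmx gU)).
rewrite -mulmxA (krylov_mulmx m_monic size_m _ mB0); apply: (canLR (mulKmx AU)).
by rewrite mulmxA (krylov_mulmx m_monic size_m _ mA0) -mulmxA mulKVmx.
Qed.

Lemma card_not_submx p (W : 'M[F]_(p, 3)) :
  #|[set u : 'rV[F]_3 | ~~ (u <= W)%MS]| = (q ^ 3 - q ^ \rank W)%N.
Proof.
rewrite cardsCs card_mx -card_rowg; congr (_ - _)%N.
by apply: eq_card => u; rewrite !inE negbK.
Qed.

Lemma class_not_eigen A v : A \in minpoly_class m -> v != 0 ->
  ~~ (v *m A <= v)%MS.
Proof.
rewrite mem_minpoly_class => /eqP mA0 v0; apply/negP=> /sub_rVP[a va].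
have /(mulmx_horner_eq0 m_irr mA0 v0) : v *m horner_mx A ('X - a%:P) = 0.
  by rewrite rmorphB /= horner_mx_X horner_mx_C mulmxBr va mul_mx_scalar subrr.
by move/dvdp_leq; rewrite polyXsubC_eq0 size_m size_XsubC => /(_ isT).
Qed.

Lemma card_class_image v w : v != 0 ->
  #|[set A in minpoly_class m | v *m A == w]| =
    if (w <= v)%MS then 0%N else (q ^ 3 - q ^ 2)%N.
Proof.
move=> v0; case: ifPn => [wv | nwv].
  apply: eq_card0 => A; rewrite inE; apply/negP=> /andP[clA /eqP vA].
  by have := class_not_eigen clA v0; rewrite vA wv.
have rk2 : \rank (v + w)%MS = 2 by rewrite mxrank_adds_row rank_rV v0 nwv.
rewrite -[X in (_ - q ^ X)%N]rk2 -card_not_submx.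
(* The free parameter is [u = v A^2]: [g u] is the prescribed Krylov matrix at [v], and [f u] the
   root having it. *)
pose g u := rows3 v w u; pose f u := invmx (g u) *m C *m g u.
have gU u : (g u \in unitmx) = ~~ (u <= v + w)%MS by exact: rows3_unit.
have kf u : ~~ (u <= v + w)%MS -> krylov v (f u) = g u.
  rewrite -gU => /krylov_companion_conj; rewrite rowK; exact.
rewrite -(card_in_imset (f := f)); last first.
  move=> u1 u2; rewrite !inE => Hu1 Hu2 eqf.
  have : row 2%:R (g u1) = row 2%:R (g u2) by rewrite -!kf // eqf.
  by rewrite !rowK.
apply: eq_card => A; apply/idP/imsetP => [|[u]].
  rewrite inE => /andP[clA /eqP vA].
  have mA0 : horner_mx A m = 0 by apply/eqP; rewrite -mem_minpoly_class.
  have gE : g (v *m A ^+ 2) = krylov v A by rewrite krylov_rows3 vA.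
  exists (v *m A ^+ 2); first by rewrite inE -gU gE (krylov_unit m_irr).
  by rewrite /f gE -(krylov_similar m_monic m_irr).
rewrite inE => Hu ->; rewrite inE minpoly_class_conj ?gU ?companion_class //=.
have : row 1 (krylov v (f u)) = row 1 (g u) by rewrite kf.
by rewrite !rowK /= expr1 => ->.
Qed.

Lemma card_minpoly_class :
  #|minpoly_class m| = ((q ^ 3 - q) * (q ^ 3 - q ^ 2))%N.
Proof.
have v0 := delta00_neq0.
pose im A : 'rV[F]_3 := delta_mx 0 0 *m A.
have -> : (q ^ 3 - q = q ^ 3 - q ^ \rank (delta_mx 0 0 : 'rV[F]_3)%R)%N.
  by rewrite rank_rV v0 expn1.
rewrite -card_not_submx -sum_nat_const -sum1_card (partition_big im predT) //=.
rewrite [RHS]big_mkcond; apply: eq_bigr => w _.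
rewrite sum1_card inE -if_neg negbK -(card_class_image _ v0).
by apply: eq_card => A; rewrite [RHS]inE.
Qed.

(** * Singular differences and the degree *)

Lemma class_unit A : A \in minpoly_class m -> A \in unitmx.
Proof.
move=> clA; rewrite -row_free_unit -kermx_eq0; apply/rowV0P=> v /sub_kermxP vA0.
apply/eqP; apply: contraT => /(class_not_eigen clA).
by rewrite vA0 sub0mx.
Qed.

Lemma class_eq A B v : A \in minpoly_class m -> B \in minpoly_class m ->
  v != 0 -> v *m A = v *m B -> v *m A ^+ 2 = v *m B ^+ 2 -> A = B.
Proof.
rewrite !mem_minpoly_class // => /eqP mA0 /eqP mB0 v0 eq1 eq2.
apply: (krylov_inj m_monic m_irr size_m mA0 mB0 v0).
by rewrite !krylov_rows3 eq1 eq2.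
Qed.

Lemma rank_ker_class_sub A B : A \in minpoly_class m -> B \in minpoly_class m ->
  A != B -> (\rank (kermx (A - B)) <= 1)%N.
Proof.
move=> clA clB neAB; set W := kermx _; rewrite leqNgt; apply/negP=> rkW.
have kerP u : (u <= W)%MS -> u *m A = u *m B.
  by move/sub_kermxP/eqP; rewrite mulmxBr subr_eq0 => /eqP.
(* [W] and [W A] both have dimension at least 2 in a 3-space, so they meet; a common nonzero vector
   is [x = v A] with [v] and [v A] in [W]. *)
have : (W :&: W *m A)%MS != 0.
  rewrite -mxrank_eq0 -lt0n; have := mxrank_sum_cap W (W *m A).
  rewrite mxrankMfree ?row_free_unit ?class_unit //.
  have := rank_leq_col (W + W *m A)%MS; lia.
case/rowV0Pn=> x; rewrite sub_capmx => /andP[xW /submxP[D]].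
rewrite mulmxA => defx x0; have vW : (D *m W <= W)%MS by exact: submxMl.
have v0 : D *m W != 0 by apply: contraNneq x0 => v0; rewrite defx v0 mul0mx.
case/eqP: neAB; apply: (class_eq clA clB v0); first exact: kerP.
by rewrite !expr2 -!mulmxE !(mulmxA (D *m W)) -(kerP _ vW) -defx kerP.
Qed.

Lemma card_agree A B : A \in minpoly_class m -> B \in minpoly_class m ->
  A != B -> A - B \notin unitmx ->
  #|[set v : 'rV[F]_3 | (v != 0) && (v *m B == v *m A)]| = q.-1.
Proof.
move=> clA clB neAB; rewrite -row_free_unit -kermx_eq0 -mxrank_eq0 => rk0.
have rk1 : \rank (kermx (A - B)) = 1%N.
  by have := rank_ker_class_sub clA clB neAB; case: (\rank _) rk0 => [|[|?]].
have := card_rowg (kermx (A - B)).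
rewrite rk1 expn1 (cardsD1 0) inE sub0mx => <-; rewrite add1n /=.
apply: eq_card => v; rewrite !inE; congr (_ && _).
by rewrite (sameP sub_kermxP eqP) mulmxBr subr_eq0 eq_sym.
Qed.

Lemma card_singular A : A \in minpoly_class m ->
  (#|[set B in minpoly_class m | (B != A) && (A - B \notin unitmx)%R]| * q.-1 =
   (q ^ 3).-1 * (q ^ 3 - q ^ 2).-1)%N.
Proof.
move=> clA; rewrite -sum_nat_const.
transitivity (\sum_(B in [set B in minpoly_class m |
                           (B != A) && (A - B \notin unitmx)%R])
  \sum_(v : 'rV[F]_3 | (v != 0)%R && (v *m B == v *m A)) 1)%N.
  apply: eq_bigr => B; rewrite inE => /and3P[clB neBA sAB].
  by rewrite sum1dep_card card_agree // eq_sym.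
rewrite (exchange_big_dep (fun v => v != 0)) /=; last by move=> B v _ /andP[].
transitivity (\sum_(v : 'rV[F]_3 | (v != 0)%R) (q ^ 3 - q ^ 2).-1)%N.
  apply: eq_bigr => v v0; rewrite sum1dep_card.
  have := card_class_image (v *m A) v0.
  rewrite (negPf (class_not_eigen clA v0)) => <-.
  rewrite [in RHS](cardsD1 A) inE clA eqxx /=.
  apply: eq_card => B; rewrite !inE v0 /=.
  (* A common value at [v != 0] already makes [A - B] singular. *)
  rewrite andbCA -!andbA; do 2![apply: andb_id2l => _]; apply: andb_idl => /eqP eqv.
  apply: contra v0 => /mulmxK/(_ v) <-.
  by rewrite mulmxBr eqv subrr mul0mx.
rewrite sum_nat_const; congr (_ * _)%N.
by rewrite -(card_mx F 1 3) -(cardC1 (0 : 'rV[F]_3)); apply: eq_card.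
Qed.

Lemma card_degree A : A \in minpoly_class m ->
  #|[set B in minpoly_class m | A - B \in unitmx]| =
    ((q ^ 3 - q ^ 2 - q) * (q ^ 3 - q ^ 2 - q - 1))%N.
Proof.
move=> clA; have := card_singular clA; set s := #|_| => eqs.
have : #|minpoly_class m| =
    (1 + s + #|[set B in minpoly_class m | (A - B \in unitmx)%R]|)%N.
  rewrite -(cardsID [set B | A - B \in unitmx]) addnC; congr (_ + _)%N.
    rewrite (cardsD1 A) in_setD clA inE subrr unitmxE det0 unitr0 /=; congr (_ + _)%N.
    apply: eq_card => B; rewrite !inE.
    by rewrite [LHS]andbA [LHS]andbC.
  by apply: eq_card => B; rewrite !inE.
rewrite card_minpoly_class //.
apply: degree_arith eqs => //; exact: finNzRing_gt1.
Qed.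

(** * The clique *)

Definition clique_class : {set 'M[F]_3} :=
  [set A in minpoly_class m | \sum_(i < 3) row i (A ^+ i) == 0].

(* Expanding each [e_i] in the basis [v, v A, f] with [f = v A^2], the equation
   defining [clique_class] becomes [f k(D) = - v mu(D)] for [D = A] and for
   [D = B]. Since [k] is invertible modulo [m], [f = v rho(D)] with the same
   [rho] for both, hence [rho = X^2] modulo [m] and [v B^2 = f]. *)
Lemma clique_class_eq A B v : A \in clique_class -> B \in clique_class ->
  v != 0 -> v *m A = v *m B -> A = B.
Proof.
rewrite !inE -!/(minpoly_class m) !mxminpoly_irreducible //.
move=> /andP[/eqP mA0 /eqP sumA] /andP[/eqP mB0 /eqP sumB] v0 eq_vAB.
set f := v *m A ^+ 2; pose K := invmx (krylov v A).
have kU := krylov_unit m_irr size_m mA0 v0.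
have defe i : row i 1%:M = K i 0 *: v + K i 1 *: (v *m A) + K i 2%:R *: f.
  rewrite -(mulVmx kU) row_mul mulmx_sum_row !big_ord_recl big_ord0 addr0 addrA.
  rewrite krylov_rows3 !rowK /= !mxE.
  do ![rewrite (_ : lift _ _ = 1); last exact: val_inj
     | rewrite (_ : lift _ _ = 2%:R); last exact: val_inj].
  by rewrite /K krylov_rows3.
(* [k] collects the coordinates of the [e_i] along [f], and [mu] those along [v] and [v A]; as
   [v A = v D], the term [v A D^i] contributes [X^(i+1)]. *)
pose k := rVpoly (col 2%:R K)^T.
pose mu := \sum_(i < 3) (K i 0 *: 'X^i + K i 1 *: 'X^(i.+1)).
have k_ndvd : ~~ (m %| k).
  have k0 : k != 0.
    apply/negP=> /eqP k0.
    have : col 2%:R K = 0 by apply: trmx_inj; rewrite trmx0 -[LHS]rVpolyK -/k k0 linear0.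
    rewrite colE => /(canRL (mulKmx _)); rewrite unitmx_inv => /(_ kU) /colP/(_ 2%:R).
    by rewrite mulmx0 !mxE !eqxx => /eqP; rewrite oner_eq0.
  by apply/negP=> /(dvdp_leq k0); rewrite size_m leqNgt ltnS size_poly.
have rel D : \sum_(i < 3) row i (D ^+ i) = 0 -> v *m A = v *m D ->
    f *m horner_mx D k = - (v *m horner_mx D mu).
  move=> sumD eqD; apply/eqP; rewrite -addr_eq0 -sumD -mulmx_krylov mulmx_sum_row.
  rewrite /mu raddf_sum mulmx_sumr -big_split; apply/eqP/eq_bigr=> i _ /=.
  rewrite rowK -[D ^+ i in RHS]mul1mx row_mul defe !mulmxDl -!scalemxAl !mxE.
  rewrite rmorphD /= !horner_mxZ !rmorphXn /= horner_mx_X mulmxDr -!scalemxAr.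
  by rewrite exprS eqD -!mulmxA -mulmxE addrC.
have [s invk] := horner_mx_inv 2 m_irr k_ndvd.
have deff D : horner_mx D m = 0 -> \sum_(i < 3) row i (D ^+ i) = 0 ->
    v *m A = v *m D -> f = v *m horner_mx D (- (mu * s)).
  move=> mD0 sumD eqD; rewrite -[f]mulmx1 -(invk D mD0) mulmxA rel //.
  by rewrite rmorphN rmorphM /= mulNmx -mulmxA mulmxN.
have dvdX2 : m %| 'X^2 + mu * s.
  apply: (mulmx_horner_eq0 m_irr mA0 v0).
  rewrite -[mu * s]opprK rmorphB /= mulmxBr -deff //.
  by rewrite rmorphXn /= horner_mx_X subrr.
apply: (krylov_inj m_monic m_irr size_m mA0 mB0 v0).
rewrite !krylov_rows3 -/f eq_vAB (deff B) //; congr rows3.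
have /dvdpP[t def_t] := dvdX2.
have := congr1 (horner_mx B) def_t.
rewrite rmorphM /= mB0 mulr0 rmorphD rmorphXn /= horner_mx_X => /eqP.
by rewrite addr_eq0 rmorphN => /eqP ->.
Qed.

Lemma card_clique_parameters (c d : F) :
  #|[set r : 'rV[F]_3 |
      r 0 1 * (r 0 1 + 1 + d * r 0 2%:R) - r 0 2%:R * (r 0 0 + c * r 0 2%:R) != 0]|
  = (q ^ 3 - q ^ 2 - q)%N.
Proof.
(* For [x != 0] the condition excludes exactly one [z], whatever [y] is. *)
pose P x y z := y * (y + 1 + d * x) - x * (z + c * x) != 0.
pose f (t : F * (F * F)) : 'rV[F]_3 := \row_j [:: t.2.2; t.2.1; t.1]`_j.
have f_bij : bijective f.
  exists (fun r => (r 0 2%:R, (r 0 1, r 0 0))) => [[x [y z]]|r]; first by rewrite !mxE.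
  apply/rowP=> j; rewrite mxE; case: j => [[|[|[|//]]] lt_j] /=;
    by congr (r _ _); apply: val_inj.
rewrite -sum1_card (reindex f) /=; last exact: onW_bij.
transitivity (\sum_x \sum_y \sum_(z | P x y z) 1)%N.
  transitivity (\sum_x \sum_(t | P x t.1 t.2) 1)%N; last first.
    by apply: eq_bigr => x _; rewrite pair_big_dep.
  by rewrite pair_big_dep; apply: eq_bigl => t; rewrite inE !mxE.
(* At [x = 0] the condition is [y (y + 1) != 0]: it excludes the two distinct values [0] and [-1] of
   [y] and leaves [z] free. *)
have c0 : (\sum_y \sum_(z | P 0%R y z) 1 = (q - 2) * q)%N.
  have <- : #|[set~ 0 : F] :\ -1| = (q - 2)%N.
    have := cardsD1 (-1) [set~ (0 : F)]; rewrite cardsC1 !inE oppr_eq0 oner_neq0 /=.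
    by rewrite subn2 => ->.
  rewrite -sum_nat_const [RHS]big_mkcond; apply: eq_bigr => y _.
  rewrite /P !inE; under eq_bigl => z do
    rewrite mulr0 mul0r addr0 subr0 mulf_eq0 addr_eq0 negb_or andbC.
  by case: ifP => _; rewrite ?big_pred0_eq // sum1_card cardT -cardE.
have cN0 x : x != 0 -> (\sum_y \sum_(z | P x y z) 1 = q * q.-1)%N.
  move=> x0; rewrite -[X in (X * _)%N]/#|F| -sum_nat_const; apply: eq_bigr => y _.
  rewrite -(cardC1 (y * (y + 1 + d * x) / x - c * x)) sum1_card; apply: eq_card => z.
  rewrite !inE [in RHS]eq_sym subr_eq (can2_eq (divfK x0) (mulfK x0)) (mulrC (z + _)).
  by rewrite -topredE /= /P subr_eq0.
rewrite (bigD1 0) //= c0 (eq_bigr _ cN0) sum_nat_const cardC1.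
have := finNzRing_gt1 F; case: q => [|[|n]] // _.
by rewrite subn2 -subnDA /=; apply/esym/(canLR (addnK _)); ring.
Qed.

(* With [P = clique_basis r] and [B = P C P^-1], the three rows [e_i P] are such
   that [e_2 P = e_0] and [e_0 P + e_1 P C + e_2 P C^2 = 0]; [r = e_1 P] is free. *)
Definition clique_basis r : 'M[F]_3 :=
  rows3 (- (delta_mx 0 2%:R + r *m C)) r (delta_mx 0 0).

Definition clique_mx r : 'M[F]_3 :=
  clique_basis r *m C *m invmx (clique_basis r).

Lemma companion_delta2 : delta_mx 0 0 *m C ^+ 2 = delta_mx 0 2%:R :> 'rV_3.
Proof.
have /(congr1 (row 2%:R)) := krylov_companion 2 m.
by rewrite rowK => ->; rewrite rowE mulmx1.
Qed.

Lemma clique_mx_class r : clique_basis r \in unitmx ->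
  clique_mx r \in clique_class.
Proof.
set P := clique_basis r => PU; have PU' : invmx P \in unitmx by rewrite unitmx_inv.
have clP := minpoly_class_conj PU' companion_class.
rewrite invmxK in clP; rewrite inE clP /=.
have powP i : clique_mx r ^+ i = P *m C ^+ i *m invmx P.
  have := horner_mx_uconj 'X^i C PU; rewrite !rmorphXn /= !horner_mx_X; exact.
rewrite (eq_bigr (fun i : 'I_3 => row i P *m C ^+ i *m invmx P)) => [|i _]; last first.
  by rewrite powP !row_mul.
rewrite !big_ord_recl big_ord0 !rowK /= expr0 mulmx1 expr1 companion_delta2.
by rewrite addr0 -!mulmxDl [r *m C + _]addrC addNr mul0mx.
Qed.

(** The normalization [e_2 P = e_0] makes [P^-1] the Krylov matrix of [B] at [e_2], so [B]
    determines [P] and its middle row [r]. *)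
Lemma clique_mx_inj : {in [pred r | clique_basis r \in unitmx] &, injective clique_mx}.
Proof.
have invP r : clique_basis r \in unitmx ->
    krylov (delta_mx 0 2%:R) (clique_mx r) = invmx (clique_basis r).
  move=> PU; have PU' : invmx (clique_basis r) \in unitmx by rewrite unitmx_inv.
  have := krylov_companion_conj PU'; rewrite invmxK.
  suff -> : row 0 (invmx (clique_basis r)) = delta_mx 0 2%:R by [].
  rewrite rowE; apply: (canLR (mulmxK PU)).
  by rewrite -rowE rowK.
move=> r1 r2 /= P1 P2 eq12.
have /(congr1 invmx) : invmx (clique_basis r1) = invmx (clique_basis r2).
  by rewrite -!invP // eq12.
by rewrite !invmxK => /(congr1 (row 1)); rewrite !rowK.
Qed.

Lemma det_clique_basis r : \det (clique_basis r) =
  r 0 1 * (r 0 1 + 1 - m`_2 * r 0 2%:R) - r 0 2%:R * (r 0 0 - m`_1 * r 0 2%:R).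
Proof.
rewrite det_rows3 !mxE !big_ord_recl !big_ord0 !mxE /=.
do ![rewrite (_ : lift _ _ = 1); last exact: val_inj
   | rewrite (_ : lift _ _ = 2%:R); last exact: val_inj].
rewrite /=; ring.
Qed.

Lemma card_clique_mx :
  #|clique_mx @: [set r | clique_basis r \in unitmx]| = (q ^ 3 - q ^ 2 - q)%N.
Proof.
rewrite card_in_imset => [|r1 r2]; last by rewrite !inE; apply: clique_mx_inj.
rewrite -(card_clique_parameters (- m`_1) (- m`_2)); apply: eq_card => r.
by rewrite !inE unitmxE unitfE det_clique_basis !mulNr.
Qed.

End MinpolyClass.

Local Close Scope ring_scope.

(** * Transfer of the matrix counts to the graph *)

Theorem proposition6p1 (F : finFieldType) (q : nat) (hq : #|F| = q)
    (m : {poly F}) (m_monic : m \is monic) (m_irr : irreducible_poly m)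
    (m_cubic : size m = 4) :
  [/\ #|vertex (Gamma m)| = (q ^ 3 - q) * (q ^ 3 - q ^ 2),
      vertex_transitive (Gamma m),
      regular_of_degree (Gamma m)
        ((q ^ 3 - q ^ 2 - q) * (q ^ 3 - q ^ 2 - q - 1))
    & exists2 S : {set vertex (Gamma m)},
        clique S & #|S| = q ^ 3 - q ^ 2 - q].
Proof.
Local Open Scope ring_scope.
rewrite -hq; split.
- by rewrite card_sig -(card_minpoly_class m_monic m_irr m_cubic) cardsE.
- move=> x y.
  have [g gU conj_xy] := class_conjugate m_monic m_irr m_cubic (valP x) (valP y).
  have fP (z : vertex (Gamma m)) : invmx g *m val z *m g \in minpoly_class m.
    exact: minpoly_class_conj (valP z).
  (* Conjugation by [g] is linear and preserves invertibility, hence adjacency. *)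
  pose f z : vertex (Gamma m) := exist (fun A => A \in minpoly_class m) _ (fP z).
  have f_inj : injective f.
    move=> z t /(congr1 val) /= /(congr1 (fun M => g *m M *m invmx g)).
    by rewrite -!mulmxA !mulKVmx // !mulmxV // !mulmx1 => /val_inj.
  exists (perm f_inj); last by apply: val_inj; rewrite permE.
  move=> z t; rewrite !permE /= /gamma_adj /= -mulmxBl -mulmxBr.
  by rewrite !unitmx_mul unitmx_inv gU andbT.
- move=> x; rewrite -(card_degree m_monic m_irr m_cubic (valP x)).
  exact: (card_sig_set _ (fun B => val x - B \in unitmx)).
pose S := clique_mx m @: [set r | clique_basis m r \in unitmx].
have clS A : A \in S -> A \in clique_class m.
  by case/imsetP=> r; rewrite inE => rU ->; apply: clique_mx_class.
exists [set x : vertex (Gamma m) | val x \in S] => [x y | ].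
  rewrite !inE => /clS clx /clS cly; apply: contraR.
  (* A singular difference yields [v != 0] with equal images under both vertices, which forces them
     to coincide. *)
  rewrite /= /gamma_adj -row_free_unit -kermx_eq0 => /rowV0Pn[v /sub_kermxP/eqP].
  rewrite mulmxBr subr_eq0 => /eqP eqv v0.
  by apply/eqP/val_inj/(clique_class_eq m_monic m_irr m_cubic clx cly v0 eqv).
rewrite (card_sig_set _ [in S]) -(card_clique_mx m).
apply: eq_card => A; rewrite inE andb_idl // => /clS.
by rewrite inE => /andP[].
Qed.
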